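(* Let $f:\mathbb{R}^n\to\mathbb{R}^n$ and $g:\mathbb{R}^n\to\mathbb{R}^{n\times m}$ be of class $C^1$ with $f(0)=0$. Suppose that there exist class $C^1$ functions $k:\mathbb{R}^n\to\mathbb{R}^m$, $l:\mathbb{R}^\nu\to\mathbb{R}^m$, and $s:\mathbb{R}^\nu\to\mathbb{R}^\nu$ with $k(0)=0$, $l(0)=0$, and $s(0)=0$, satisfying the following three conditions: 1) the system $\dot w=s(w)$ admits a nonlinear right eigenvalue $\lambda(w)$ and an associated nonlinear right eigenvector $v(w)$ on $\mathbb{R}^\nu$; 2) the nonlinear Sylvester equation $$f(\pi(w))+g(\pi(w))\,l(w)=\frac{\partial \pi(w)}{\partial w}s(w)$$ has a class $C^1$ solution $\pi:\mathbb{R}^\nu\to\mathbb{R}^n$ on $\mathbb{R}^\nu$ such that $\pi(0)=0$ and $k(\pi(w))=l(w)$ holds for all $w\in\mathbb{R}^\nu$; 3) there exist $\tilde\lambda:\mathbb{R}^n\to\mathbb{C}$ of class $C^0$ and $\tilde v:\mathbb{R}^n\to\mathbb{C}^n$ of class $C^1$ such that $$\tilde\lambda(\pi(w))=\lambda(w),\qquad \tilde v(\pi(w))=\frac{\partial\pi(w)}{\partial w}v(w)$$ hold for all $w\in\mathbb{R}^\nu$, and $\tilde v(\pi(w))\neq 0_{n\times 1}$ for all $w\in\mathbb{R}^\nu$. Then $\tilde\lambda(x)$ is a nonlinear right eigenvalue of the closed-loop system $\dot x=\tilde f(x):=f(x)+g(x)k(x)$ on the set $\pi(\mathbb{R}^\nu):=\{x: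 x=\pi(w),\ w\in\mathbb{R}^\nu\}$, with associated nonlinear right eigenvector $\tilde v(x)$; that is, $[\tilde v(x),\tilde f(x)]=\tilde\lambda(x)\tilde v(x)$ for all $x\in\pi(\mathbb{R}^\nu)$.
   Context: For differentiable vector fields $v,s:\mathbb{R}^d\to\mathbb{C}^d$, the Lie bracket is $[v(w),s(w)]:=\frac{\partial s(w)}{\partial w}v(w)-\frac{\partial v(w)}{\partial w}s(w)$. Definition (nonlinear right eigenvalue/eigenvector). Let $s:\mathbb{R}^d\to\mathbb{R}^d$ be of class $C^1$ with $s(0)=0$ and let $D\subseteq\mathbb{R}^d$. A class $C^0$ function $\lambda$ with values in $\mathbb{C}$ and a class $C^1$ function $v$ with values in $\mathbb{C}^d$ that is nonzero on $D$ are called, respectively, a nonlinear right eigenvalue and an associated nonlinear right eigenvector of $\dot w=s(w)$ on $D$ if $[v(w),s(w)]=\lambda(w)v(w)$ for all $w\in D$. In the conclusion of the claim, $\tilde v$ and $\tilde\lambda$ are defined on all of $\mathbb{R}^n$, derivatives are taken in $\mathbb{R}^n$, and the identity is evaluated at points of $\pi(\mathbb{R}^\nu)$. Here $n,m,\nu$ are positive integers, and $C^k$ means $k$ times continuously differentiable. *)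

(* Defs.v *)
From HB Require Import structures.
From mathcomp Require Import all_boot all_order all_algebra.
From mathcomp Require Import complex.
From mathcomp Require Import all_classical all_reals all_analysis.

Set Implicit Arguments.
Unset Strict Implicit.
Unset Printing Implicit Defensive.

Import Order.TTheory GRing.Theory Num.Theory.
Import numFieldNormedType.Exports.

Local Open Scope classical_set_scope.
Local Open Scope ring_scope.
Local Open Scope complex_scope.

(* Since 'cV[R]_d is finite dimensional, pointwise continuity of x |-> 'd f x u
   for every u is the same as continuity of x |-> 'd f x in operator norm. *)
Definition C1 (R : realType) (d : nat) (W : normedModType R)
    (f : 'cV[R]_d -> W) : Prop :=
  (forall x, differentiable f x) /\
  (forall u : 'cV[R]_d, continuous (fun x => 'd f x u : W)).

(* R[i] is not a normed module over R in the library, so differentiation in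
   real variables of complex-valued maps goes through real and imaginary
   parts. *)
Definition C1c (R : realType) (d p : nat)
    (F : 'cV[R]_d -> 'cV[R[i]]_p) : Prop :=
  C1 (fun x => map_mx (@complex.Re R) (F x)) /\
  C1 (fun x => map_mx (@complex.Im R) (F x)).

(* The library's jacobian acts on row vectors; this is the column convention,
   with (i, j) entry the j-th partial derivative of the i-th component. *)
Definition jac (R : realType) (d p : nat) (F : 'cV[R]_d -> 'cV[R]_p)
    (x : 'cV[R]_d) : 'M[R]_(p, d) :=
  \matrix_(i < p, j < d) 'D_(delta_mx j 0) (fun y => F y i 0) x.

Definition jacc (R : realType) (d p : nat) (F : 'cV[R]_d -> 'cV[R[i]]_p)
    (x : 'cV[R]_d) : 'M[R[i]]_(p, d) :=
  \matrix_(i < p, j < d)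
    (('D_(delta_mx j 0) (fun y => complex.Re (F y i 0)) x) +i*
     ('D_(delta_mx j 0) (fun y => complex.Im (F y i 0)) x)).

Definition cplx (R : realType) (m n : nat) (A : 'M[R]_(m, n)) : 'M[R[i]]_(m, n) :=
  map_mx (real_complex R) A.

Definition lie_bracket (R : realType) (d : nat)
    (v s : 'cV[R]_d -> 'cV[R[i]]_d) (w : 'cV[R]_d) : 'cV[R[i]]_d :=
  jacc s w *m v w - jacc v w *m s w.

(* R[i]^o carries the usual topology of the complex plane (from the modulus). *)
Definition nonlinear_right_eigenpair (R : realType) (d : nat)
    (D : set 'cV[R]_d) (s : 'cV[R]_d -> 'cV[R]_d)
    (lambda : 'cV[R]_d -> R[i]) (v : 'cV[R]_d -> 'cV[R[i]]_d) : Prop :=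
  [/\ C1 s /\ s 0 = 0,
      continuous (lambda : 'cV[R]_d -> R[i]^o),
      C1c v,
      (forall w, D w -> v w <> 0) &
      (forall w, D w ->
         lie_bracket v (fun y => cplx (s y)) w = lambda w *: v w)].

(* Main.v *)
(** The only difficulty is that [pi] is merely C^1, so the textbook proof that
    pi-related vector fields have pi-related brackets, which uses the symmetry
    of the second derivative of [pi], is not available.  Instead, let [phi] be a
    component of [pi] and let [X], [Y] be vector fields such that [dphi(X)] and
    [dphi(Y)] are differentiable at [w].  By the mean value theorem, the
    second difference of [phi] at [w] along [t X(w)] and [t Y(w)], divided by
    [t^2], tends to [d(dphi(Y))(X) - dphi(dY(X))] at [w].  Since the second
    difference is symmetric in the two directions, exchanging [X] and [Y] gives
    [d(dphi(Y))(X) - d(dphi(X))(Y) = dphi([X, Y])].  Apply this with [Y = s]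
    and [X] the real and the imaginary part of [v]. *)
Require Import Defs.
From HB Require Import structures.
From mathcomp Require Import all_boot all_order all_algebra.
From mathcomp Require Import complex.
From mathcomp Require Import all_classical all_reals all_analysis.
From mathcomp Require Import ring.
Import Order.TTheory GRing.Theory Num.Theory.
Import numFieldNormedType.Exports.
Local Open Scope classical_set_scope.
Local Open Scope ring_scope.
Local Open Scope complex_scope.

(** * Limits from the right at 0 and first-order remainders *)

Lemma cvg_right0_linear_bound {R : realType} {V : normedModType R}
    {h : R -> V} {C : R} :
  (\forall t \near 0^'+, `|h t| <= C * t) -> h t @[t --> 0^'+] --> (0 : V).
Proof.
move=> hC; apply/cvgr0Pnorm_le => d d0; near=> t.
have t0 : 0 < t by near: t; exact: nbhs_right_gt.
have K0 : 0 < `|C| + 1 by rewrite ltr_wpDl.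
apply: (@le_trans _ _ (C * t)); first by near: t.
apply: (@le_trans _ _ ((`|C| + 1) * t)).
  by rewrite ler_pM2r// (le_trans (ler_norm C))// lerDl.
rewrite -ler_pdivlMl// mulrC; near: t; apply: nbhs_right_le.
by rewrite divr_gt0.
Unshelve. all: by end_near. Qed.

(** The remainder of the first-order expansion is [o(h t)], hence [o(t)] because [h t] is [O(t)].
    Nothing else is asked of [h], so it may contain a mean value point that depends on [t] without
    any regularity. *)
Lemma cvg_diff_remainder {R : realType} {V W : normedModType R} {F : V -> W}
    {w : V} {h : R -> V} {C : R} :
  differentiable F w -> (\forall t \near 0^'+, `|h t| <= C * t) ->
  t^-1 *: (F (w + h t) - F w - 'd F w (h t)) @[t --> 0^'+] --> (0 : W).
Proof.
move=> /diff_locallyx dF hC; apply/cvgr0Pnorm_le => e e0.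
(* [C] may be zero or negative; a positive bound is needed to divide [e] by it. *)
pose K := `|C| + 1.
have K0 : 0 < K by rewrite ltr_wpDl.
have hK : \forall t \near 0^'+, `|h t| <= K * t.
  near=> t; apply: (@le_trans _ _ (C * t)); first by near: t.
  have t0 : 0 < t by near: t; exact: nbhs_right_gt.
  by rewrite ler_pM2r// (le_trans (ler_norm C))// lerDl.
have h0 := cvg_right0_linear_bound hC.
have dFe : \forall y \near (0 : V),
    `|F (y + w) - F w - 'd F w y| <= e / K * `|y|.
  have eK0 : 0 < e / K by rewrite divr_gt0.
  near=> y.
  have aux (a b o : W) : a + b + o - a - b = o.
    by rewrite -addrA -opprD [_ + o]addrC addrK.
  rewrite dF aux.
  by near: y; apply: littleoP.
near=> t.
have t0 : 0 < t by near: t; exact: nbhs_right_gt.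
rewrite normrZ gtr0_norm ?invr_gt0// ler_pdivrMl// [w + _]addrC.
apply: (@le_trans _ _ (e / K * `|h t|)); first by near: t; exact: (h0 _ dFe).
rewrite mulrAC ler_pdivrMr// [t * e]mulrC -mulrA ler_pM2l// mulrC.
by near: t.
Unshelve. all: by end_near. Qed.

(** Serves to pass to the limit in ['d phi (y t) (z t)], where the base point and the direction both
    move with [t]. *)
Lemma cvg_uncurry {T : Type} {F : set_system T} {U V W : topologicalType}
    (D : U -> V -> W) (y : T -> U) (z : T -> V) (y0 : U) (z0 : V) :
  Filter F -> continuous (fun p => D p.1 p.2) -> y @ F --> y0 -> z @ F --> z0 ->
  D (y t) (z t) @[t --> F] --> D y0 z0.
Proof.
move=> FF DC yy0 zz0.
apply: (@cvg_comp _ _ _ (fun t => (y t, z t)) (fun p => D p.1 p.2) _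
  (nbhs (y0, z0))); first exact: cvg_pair.
by move: (DC (y0, z0)); exact.
Qed.

(** * Second differences and the bracket identity for a scalar function *)

Section second_difference.
Context {R : realType} {V : normedModType R}.
Context {phi : V -> R} {Y : V -> V} {w : V}.
Hypothesis dphi : forall x, differentiable phi x.
Hypothesis dphiC : continuous (fun p : V * V => 'd phi (p.1 : V) p.2).
Hypothesis dY : differentiable Y w.
Hypothesis dQ : differentiable (fun x => 'd phi x (Y x)) w.

(** The limit is what the Leibniz rule would give for the second derivative of [phi] in the
    directions [U] and [Y w], expressed through the differential of [x |-> 'd phi x (Y x)] alone. *)
Lemma cvg_second_difference (U : V) :
  t^-1 * (t^-1 * ((phi (w + t *: U + t *: Y w) - phi (w + t *: U)) -
                  (phi (w + t *: Y w) - phi w)))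
    @[t --> 0^'+] -->
  'd (fun x => 'd phi x (Y x)) w U - 'd phi w ('d Y w U).
Proof.
set Q := fun x => 'd phi x (Y x); set v := Y w.
(* Mean value theorem on [[0, t]] for [b |-> phi (w + t *: U + b *: v) - phi (w + b *: v)]. For
   [t <= 0] the witness 0 is a dummy, so that [choice] yields a total function [b]. *)
have mvt t : exists b, 0 < t -> [/\ 0 < b, b < t &
    (phi (w + t *: U + t *: v) - phi (w + t *: U)) - (phi (w + t *: v) - phi w)
    = t * ('d phi (w + t *: U + b *: v) v - 'd phi (w + b *: v) v)].
  have [t0|t0] := boolP (0 < t); last by exists 0.
  pose h b := phi (w + t *: U + b *: v) - phi (w + b *: v).
  pose dh b := 'd phi (w + t *: U + b *: v) v - 'd phi (w + b *: v) v.
  have hd (x : R) : is_derive x (1 : R) h (dh x).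
    have aff c : is_derive x (1 : R) (fun b => phi (c + b *: v))
        ('d phi (c + x *: v) v).
      have dl : is_diff x (fun b => c + b *: v) (fun b => b *: v).
        have -> : (fun b => b *: v) = cst 0 + ( *:%R^~ v).
          by apply/funext => b /=; rewrite [RHS]add0r.
        exact: is_diffD.
      have dc : is_diff x (phi \o (fun b => c + b *: v))
          ('d phi (c + x *: v) \o (fun b => b *: v)).
        by apply: is_diff_comp; exact: differentiableP.
      have dd : differentiable (phi \o (fun b => c + b *: v)) x.
        exact: ex_diff.
      apply: DeriveDef; first exact: diff_derivable.
      by rewrite deriveE// diff_val /= scale1r.
    exact: is_deriveB.
  have hc : {within `[0, t], continuous h}.
    by apply: derivable_within_continuous => x _; exact: ex_derive.
  have [b] := MVT t0 (fun x _ => hd x) hc.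
  rewrite in_itv /= => /andP[b0 bt]; rewrite /h /dh subr0 !scale0r !addr0 => e.
  exists b => _; split => //.
  rewrite mulrC -e !opprB addrACA [RHS]addrACA; congr (_ + _).
  by rewrite addrC.
have {mvt}[b hb] := choice mvt.
(* Displacements from [w] of the two points where the mean value theorem evaluates the differential;
   both are [O(t)] since [0 < b t < t]. *)
pose h1 t := t *: U + b t *: v; pose h0 t := b t *: v.
have bt : \forall t \near 0^'+, `|b t| <= t.
  near=> t; have t0 : 0 < t by near: t; exact: nbhs_right_gt.
  by have [b0 bt _] := hb t t0; rewrite gtr0_norm// ltW.
have h0C : \forall t \near 0^'+, `|h0 t| <= `|v| * t.
  near=> t; rewrite normrZ mulrC ler_wpM2l//.
  by near: t.
have h1C : \forall t \near 0^'+, `|h1 t| <= (`|U| + `|v|) * t.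
  near=> t; have t0 : 0 < t by near: t; exact: nbhs_right_gt.
  rewrite (le_trans (ler_normD _ _))// !normrZ gtr0_norm// mulrDl mulrC lerD2l.
  by rewrite mulrC ler_wpM2l//; near: t.
have to_w h C : (\forall t \near 0^'+, `|h t| <= C * t) ->
    w + h t @[t --> 0^'+] --> w.
  move=> hC; rewrite -[X in _ --> X]addr0; apply: cvgD; first exact: cvg_cst.
  exact: cvg_right0_linear_bound hC.
have x0w := to_w _ _ h0C; have x1w := to_w _ _ h1C.
have cvg_dphi (y z : R -> V) z0 : y t @[t --> 0^'+] --> w ->
    z t @[t --> 0^'+] --> z0 ->
    'd phi (y t) (z t) @[t --> 0^'+] --> 'd phi w z0.
  move=> yw zz0.
  by apply: (cvg_uncurry (fun x u => 'd phi x u)).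
have rQ0 := cvg_diff_remainder dQ h0C; have rQ1 := cvg_diff_remainder dQ h1C.
have rY0 := cvg_diff_remainder dY h0C; have rY1 := cvg_diff_remainder dY h1C.
set B := 'd Y w; set dQw := 'd Q w.
(* For [t > 0] the coefficient lies between 0 and 1, while both differentials tend to
   ['d phi w (B v)]. *)
have osc : t^-1 * b t * ('d phi (w + h1 t) (B v) - 'd phi (w + h0 t) (B v))
    @[t --> 0^'+] --> (0 : R).
  have d0 : 'd phi (w + h1 t) (B v) - 'd phi (w + h0 t) (B v)
      @[t --> 0^'+] --> (0 : R).
    rewrite -[X in _ --> X](subrr ('d phi w (B v))).
    apply: cvgB.
      exact: (cvg_dphi _ _ _ x1w (cvg_cst _)).
    exact: (cvg_dphi _ _ _ x0w (cvg_cst _)).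
  move/cvgr0Pnorm_le : d0 => d0; apply/cvgr0Pnorm_le => e e0; near=> t.
  have t0 : 0 < t by near: t; exact: nbhs_right_gt.
  rewrite normrM -[leRHS]mul1r ler_pM//; last by near: t; exact: d0.
  rewrite normrM gtr0_norm ?invr_gt0// ler_pdivrMl// mulr1.
  by near: t.
(* With [xi = w + hi], write ['d phi xi v = Q xi - 'd phi xi (Y xi - v)] and
   expand [Q] and [Y] to first order at [w]. The only term that is not a
   remainder or a limit is the oscillation [osc], since [b t / t] is bounded
   but need not converge. *)
have -> : dQw U - 'd phi w (B U) =
    0 - 0 + dQw U - ('d phi w 0 - 'd phi w 0 + ('d phi w (B U) + 0)).
  by rewrite !subrr !add0r addr0.
apply: cvg_trans (cvgB (cvgD (cvgB rQ1 rQ0) (cvg_cst (dQw U)))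
  (cvgD (cvgB (cvg_dphi _ _ _ x1w rY1) (cvg_dphi _ _ _ x0w rY0))
    (cvgD (cvg_dphi _ _ _ x1w (cvg_cst (B U))) osc))).
apply: near_eq_cvg; near=> t.
have t0 : 0 < t by near: t; exact: nbhs_right_gt.
have [_ _ ->] := hb t t0.
rewrite mulKf ?gt_eqF// !fctE /Q -/v -[w + _ + _]addrA -/(h1 t) -/(h0 t).
set x1 := w + h1 t; set x0 := w + h0 t.
have B1 : 'd Y w (h1 t) = t *: B U + b t *: B v by rewrite /B linearD !linearZ.
have B0 : 'd Y w (h0 t) = b t *: B v by rewrite /B linearZ.
have Q1 : dQw (h1 t) = t * dQw U + b t * dQw v by rewrite /dQw linearD !linearZ.
have Q0 : dQw (h0 t) = b t * dQw v by rewrite /dQw linearZ.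
have dphiZB x a u p q :
    'd phi x (a *: (u - p - q)) = a * ('d phi x u - 'd phi x p - 'd phi x q).
  by rewrite linearZ !linearB.
have dphiZ x a u : 'd phi x (a *: u) = a * 'd phi x u by rewrite linearZ.
have dphiD x u p : 'd phi x (u + p) = 'd phi x u + 'd phi x p.
  by rewrite linearD.
rewrite B1 B0 -/Q -/dQw Q1 Q0 !dphiZB !dphiD !dphiZ.
rewrite -![_^-1 *: _]/(_ * _).
(* With every differential generalized to a scalar, what remains is a rational identity in [t], with
   [t] nonzero. *)
move: ('d phi x1 (Y x1)) ('d phi x0 (Y x0)) ('d phi x1 v) ('d phi x0 v).
move: ('d phi w v) ('d phi x1 (B v)) ('d phi x0 (B v)) ('d phi x1 (B U)).
move: (dQw U) (dQw v) (b t) => q1 q2 bt' p1 p2 p3 p4 p5 p6 p7 p8.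
by field; rewrite gt_eqF.
Unshelve. all: by end_near. Qed.
End second_difference.

(** Exchanging the increments along [X w] and [Y w] leaves the second difference unchanged, so its
    two limits agree by uniqueness; rearranging that equality gives the identity. *)
Lemma diff_bracket {R : realType} {V : normedModType R} (phi : V -> R)
    (X Y : V -> V) (w : V) :
  (forall x, differentiable phi x) ->
  continuous (fun p : V * V => 'd phi (p.1 : V) p.2) ->
  differentiable X w -> differentiable Y w ->
  differentiable (fun x => 'd phi x (X x)) w ->
  differentiable (fun x => 'd phi x (Y x)) w ->
  'd (fun x => 'd phi x (Y x)) w (X w) - 'd (fun x => 'd phi x (X x)) w (Y w) =
  'd phi w ('d Y w (X w) - 'd X w (Y w)).
Proof.
move=> dphi dphiC dX dY dP dQ.
have lXY := cvg_second_difference dphi dphiC dY dQ (X w).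
have lYX := cvg_second_difference dphi dphiC dX dP (Y w).
have swap t : (phi (w + t *: Y w + t *: X w) - phi (w + t *: Y w)) -
      (phi (w + t *: X w) - phi w) =
    (phi (w + t *: X w + t *: Y w) - phi (w + t *: X w)) -
      (phi (w + t *: Y w) - phi w).
  by rewrite [w + t *: Y w + _]addrAC; ring.
have e : 'd (fun x => 'd phi x (X x)) w (Y w) - 'd phi w ('d X w (Y w)) =
    'd (fun x => 'd phi x (Y x)) w (X w) - 'd phi w ('d Y w (X w)).
  apply: (cvg_unique _ _ lXY) => //.
  apply: cvg_trans lYX; apply: near_eq_cvg; near=> t.
  by congr (_ * (_ * _)).
rewrite linearB /=; move: e.
move: ('d (fun x => 'd phi x (X x)) w (Y w))
  ('d (fun x => 'd phi x (Y x)) w (X w)).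
move=> a b e.
rewrite -(subrK ('d phi w ('d Y w (X w))) b) -e.
by rewrite addrAC [a - _]addrC addrK addrC.
Unshelve. all: by end_near. Qed.

(** * Limits, differentials and C^1 regularity of matrix-valued maps *)

Lemma cvg_mx {R : realType} {T : Type} {F : set_system T} {FF : Filter F}
    {m n : nat} (f : T -> 'M[R]_(m, n)) (l : 'M[R]_(m, n)) :
  (forall i j, f t i j @[t --> F] --> l i j) -> f @ F --> l.
Proof.
move=> fl; apply/cvgrPdist_le => e e0; near=> t.
rewrite /Num.Def.normr/= mx_normrE (bigmax_le _ (ltW e0))//= => i _.
rewrite !mxE; move: i; near: t; apply: filter_forall => i.
by move/cvgrPdist_le : (fl i.1 i.2); apply.
Unshelve. all: by end_near. Qed.

Lemma cvg_entry {R : realType} {T : Type} {F : set_system T} {FF : Filter F}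
    {m n : nat} (f : T -> 'M[R]_(m, n)) (l : 'M[R]_(m, n)) i j :
  f @ F --> l -> f t i j @[t --> F] --> l i j.
Proof.
move=> fl; apply: (@cvg_comp _ _ _ f (fun M => M i j) _ (nbhs l)) => //.
exact: coord_continuous.
Qed.

Lemma cvg_mulmx {R : realType} {T : Type} {F : set_system T} {FF : Filter F}
    {m n p : nat} (f : T -> 'M[R]_(m, n)) (g : T -> 'M[R]_(n, p))
    (A : 'M[R]_(m, n)) (B : 'M[R]_(n, p)) :
  f @ F --> A -> g @ F --> B -> f t *m g t @[t --> F] --> A *m B.
Proof.
move=> fA gB; apply: cvg_mx => i j.
rewrite mxE; under eq_fun do rewrite mxE.
apply: cvg_big => [|k _]; first exact: add_continuous.
apply: cvgM.
  exact: cvg_entry.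
exact: cvg_entry.
Qed.

Lemma mulmx_continuous {R : realType} {m n p : nat} :
  continuous (fun q : 'M[R]_(m, n) * 'M[R]_(n, p) => q.1 *m q.2).
Proof. by move=> q; apply: cvg_mulmx; [exact: cvg_fst|exact: cvg_snd]. Qed.

Lemma col_sum_delta {R : pzRingType} {d : nat} (u : 'cV[R]_d) :
  u = \sum_j u j 0 *: delta_mx j 0.
Proof.
by rewrite [LHS]matrix_sum_delta; apply: eq_bigr => j _; rewrite big_ord1.
Qed.

Lemma differentiable_entry {R : realType} {V : normedModType R} {m n : nat}
    (F : V -> 'M[R]_(m, n)) x i j :
  differentiable F x -> differentiable (fun y => F y i j) x.
Proof.
move=> dF.
exact: (@differentiable_comp _ _ _ _ F (fun M : 'M[R]_(m, n) => M i j) _ dF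
  (differentiable_coord _ _ _)).
Qed.

Lemma diff_entry {R : realType} {V : normedModType R} {m n : nat}
    (F : V -> 'M[R]_(m, n)) x i j u :
  differentiable F x -> 'd (fun y => F y i j) x u = 'd F x u i j.
Proof.
move=> dF; rewrite -!deriveE//; last exact: differentiable_entry.
by rewrite derive_mx ?mxE//; exact: diff_derivable.
Qed.

(** Exchanges the matrix of partial derivatives for the differential, on which the analytic argument
    runs. *)
Lemma mul_jac {R : realType} {d p : nat} (F : 'cV[R]_d -> 'cV[R]_p) x u :
  differentiable F x -> jac F x *m u = 'd F x u.
Proof.
move=> dF; apply/matrixP => i j; rewrite (ord1 j) {j}.
rewrite {2}(col_sum_delta u) linear_sum mxE summxE; apply: eq_bigr => k _.
rewrite linearZ !mxE deriveE ?diff_entry//; last exact: differentiable_entry.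
by rewrite mulrC.
Qed.

(** Expanding the direction in the standard basis gives a finite sum of coordinates times
    differentials in fixed directions, each continuous in the base point. *)
Lemma C1_joint {R : realType} {d : nat} {W : normedModType R}
    (f : 'cV[R]_d -> W) :
  C1 f -> continuous (fun p : 'cV[R]_d * 'cV[R]_d => 'd f (p.1 : 'cV[R]_d) p.2).
Proof.
move=> [df fC].
have -> : (fun p : 'cV[R]_d * 'cV[R]_d => 'd f (p.1 : 'cV[R]_d) p.2) =
    (fun p => \sum_j p.2 j 0 *: 'd f (p.1 : 'cV[R]_d) (delta_mx j 0)).
  apply/funext => p; rewrite [X in 'd f _ X]col_sum_delta linear_sum.
  by apply: eq_bigr => j _; rewrite linearZ.
move=> p; apply: cvg_big => [|j _]; first exact: add_continuous.
apply: cvgZ.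
  by apply: cvg_entry; exact: cvg_snd.
apply: (@cvg_comp _ _ _ fst (fun x => 'd f x (delta_mx j 0)) _ (nbhs p.1)).
  exact: cvg_fst.
exact: fC.
Qed.

(** Leibniz rule, by composing the pair [(f, g)] with the continuous bilinear map [mulmx]. *)
Lemma diff_mulmx {R : realType} {V : normedModType R} {m n p : nat}
    (f : V -> 'M[R]_(m, n)) (g : V -> 'M[R]_(n, p)) x :
  differentiable f x -> differentiable g x ->
  is_diff x (fun y => f y *m g y) (fun u => f x *m 'd g x u + 'd f x u *m g x).
Proof.
move=> df dg.
have dfg := @differentiable_pair _ _ _ _ f g x df dg.
have db := @differentiable_bilin _ _ _ _ (@mulmx R m n p) (f x, g x)
  mulmx_continuous.
apply: DiffDef; first exact: (differentiable_comp dfg db).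
rewrite (diff_comp dfg db) diff_bilin; last exact: mulmx_continuous.
by rewrite diff_pair.
Qed.

Lemma C1D {R : realType} {d : nat} {W : normedModType R} (f g : 'cV[R]_d -> W) :
  C1 f -> C1 g -> C1 (fun x => f x + g x).
Proof.
move=> [df fC] [dg gC]; split=> [x|u]; first exact: differentiableD.
have -> : (fun x => 'd (fun x => f x + g x) x u) =
    (fun x => 'd f x u + 'd g x u).
  by apply/funext => x; rewrite diffD.
by move=> x; exact: (cvgD (fC u x) (gC u x)).
Qed.

Lemma C1_mulmx {R : realType} {d m n p : nat}
    (f : 'cV[R]_d -> 'M[R]_(m, n)) (g : 'cV[R]_d -> 'M[R]_(n, p)) :
  C1 f -> C1 g -> C1 (fun x => f x *m g x).
Proof.
move=> [df fC] [dg gC]; have dfg x := diff_mulmx f g x (df x) (dg x).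
split=> [x|u]; first exact: ex_diff.
have -> : (fun x => 'd (fun x => f x *m g x) x u) =
    (fun x => f x *m 'd g x u + 'd f x u *m g x).
  by apply/funext => x; rewrite diff_val.
move=> x.
have fx := differentiable_continuous (df x).
have gx := differentiable_continuous (dg x).
exact: (cvgD (cvg_mulmx _ _ _ _ fx (gC u x))
  (cvg_mulmx _ _ _ _ (fC u x) gx)).
Qed.

Lemma diff_comp_entry {R : realType} {U V : normedModType R} {m n : nat}
    (f : U -> V) (g : V -> 'M[R]_(m, n)) x i j u :
  differentiable f x -> differentiable g (f x) ->
  'd (fun y => (g \o f) y i j) x u = 'd g (f x) ('d f x u) i j.
Proof.
move=> df dg; rewrite diff_entry; last exact: differentiable_comp.
by rewrite diff_comp.
Qed.

(** * Brackets of vector fields related by a C^1 map *)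

(** For a component [phi] of [pi], relatedness identifies ['d phi x (X x)] with a component of
    [Xt \o pi]. This composite is differentiable at [w] although ['d phi] need not be, which is what
    [diff_bracket] requires; the chain rule then evaluates its differential. *)
Lemma related_bracket {R : realType} {d n : nat} (pi : 'cV[R]_d -> 'cV[R]_n)
    (X Y : 'cV[R]_d -> 'cV[R]_d) (Xt Yt : 'cV[R]_n -> 'cV[R]_n) (w : 'cV[R]_d) :
  C1 pi -> differentiable X w -> differentiable Y w ->
  differentiable Xt (pi w) -> differentiable Yt (pi w) ->
  (forall x, Xt (pi x) = jac pi x *m X x) ->
  (forall x, Yt (pi x) = jac pi x *m Y x) ->
  jac Yt (pi w) *m Xt (pi w) - jac Xt (pi w) *m Yt (pi w) =
  jac pi w *m (jac Y w *m X w - jac X w *m Y w).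
Proof.
move=> piC1 dX dY dXt dYt XtE YtE; have [dpi _] := piC1.
have dpiw := dpi w.
rewrite !mul_jac//; apply/matrixP => i j; rewrite (ord1 j) {j}.
rewrite [LHS]mxE [X in _ + X = _]mxE.
pose phi x := pi x i 0.
have dphi x : differentiable phi x by exact: differentiable_entry.
have phiE x u : 'd phi x u = 'd pi x u i 0 by rewrite diff_entry.
have dphiC : continuous
    (fun p : 'cV[R]_d * 'cV[R]_d => 'd phi (p.1 : 'cV[R]_d) p.2).
  have -> : (fun p : 'cV[R]_d * 'cV[R]_d => 'd phi (p.1 : 'cV[R]_d) p.2) =
      (fun p => 'd pi (p.1 : 'cV[R]_d) p.2 i 0) by apply/funext.
  by move=> p; apply: cvg_entry; exact: C1_joint.
have PE Z Zt : (forall x, Zt (pi x) = jac pi x *m Z x) ->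
    (fun x => 'd phi x (Z x)) = (fun x => (Zt \o pi) x i 0).
  by move=> ZtE; apply/funext => x; rewrite phiE /= ZtE mul_jac.
have dP Z Zt u : (forall x, Zt (pi x) = jac pi x *m Z x) ->
    differentiable Zt (pi w) ->
    differentiable (fun x => 'd phi x (Z x)) w /\
    'd (fun x => 'd phi x (Z x)) w u = 'd Zt (pi w) ('d pi w u) i 0.
  move=> ZtE dZt; rewrite (PE _ _ ZtE).
  split; first exact/differentiable_entry/differentiable_comp.
  exact: diff_comp_entry.
have [dPX PX] := dP _ _ (Y w) XtE dXt.
have [dPY PY] := dP _ _ (X w) YtE dYt.
have Xtw : Xt (pi w) = 'd pi w (X w) by rewrite XtE mul_jac.
have Ytw : Yt (pi w) = 'd pi w (Y w) by rewrite YtE mul_jac.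
rewrite Xtw Ytw.
transitivity ('d (fun x => 'd phi x (Y x)) w (X w) -
              'd (fun x => 'd phi x (X x)) w (Y w)).
  exact: (congr2 (fun a b : R => a - b) (esym PY) (esym PX)).
rewrite -phiE.
exact: diff_bracket.
Qed.

(** * Splitting complex matrices and brackets into real and imaginary parts *)

Local Notation remx := (map_mx (@complex.Re _)).
Local Notation immx := (map_mx (@complex.Im _)).

Section complex_matrices.
Context {R : realType}.
Implicit Types m n p d : nat.

Lemma cplxB m n (A B : 'M[R]_(m, n)) : cplx (A - B) = cplx A - cplx B.
Proof. exact: map_mxB. Qed.

Lemma cplxM m n p (A : 'M[R]_(m, n)) (B : 'M[R]_(n, p)) :
  cplx (A *m B) = cplx A *m cplx B.
Proof. exact: map_mxM. Qed.

Lemma cplx_Re_Im m n (A : 'M[R[i]]_(m, n)) :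
  A = cplx (remx A) + 'i%C *: cplx (immx A).
Proof.
by apply/matrixP => i j; rewrite !mxE [LHS]complexE.
Qed.

Lemma Re_cplx m n (A B : 'M[R]_(m, n)) : remx (cplx A + 'i%C *: cplx B) = A.
Proof. by apply/matrixP => i j; rewrite !mxE /=; ring. Qed.

Lemma Im_cplx m n (A B : 'M[R]_(m, n)) : immx (cplx A + 'i%C *: cplx B) = B.
Proof. by apply/matrixP => i j; rewrite !mxE /=; ring. Qed.

Lemma mul_cplx m n p (A : 'M[R]_(m, n)) (B : 'M[R[i]]_(n, p)) :
  cplx A *m B = cplx (A *m remx B) + 'i%C *: cplx (A *m immx B).
Proof. by rewrite {1}(cplx_Re_Im _ _ B) mulmxDr -scalemxAr !cplxM. Qed.

Lemma mul_cplxr m n p (A : 'M[R[i]]_(m, n)) (B : 'M[R]_(n, p)) :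
  A *m cplx B = cplx (remx A *m B) + 'i%C *: cplx (immx A *m B).
Proof. by rewrite {1}(cplx_Re_Im _ _ A) mulmxDl -scalemxAl !cplxM. Qed.

Lemma Re_jacc d p (F : 'cV[R]_d -> 'cV[R[i]]_p) x :
  remx (jacc F x) = jac (fun y => remx (F y)) x.
Proof.
apply/matrixP => i j; rewrite !mxE /=; congr ('D_ _ _ _).
by apply/funext => y; rewrite mxE.
Qed.

Lemma Im_jacc d p (F : 'cV[R]_d -> 'cV[R[i]]_p) x :
  immx (jacc F x) = jac (fun y => immx (F y)) x.
Proof.
apply/matrixP => i j; rewrite !mxE /=; congr ('D_ _ _ _).
by apply/funext => y; rewrite mxE.
Qed.

Lemma jacc_cplx d p (F : 'cV[R]_d -> 'cV[R]_p) x :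
  jacc (fun y => cplx (F y)) x = cplx (jac F x).
Proof.
apply/matrixP => i j; rewrite !mxE; congr (_ +i* _).
  by congr ('D_ _ _ _); apply/funext => y; rewrite mxE.
rewrite (_ : (fun y => _) = cst 0) ?derive_cst//.
by apply/funext => y; rewrite mxE.
Qed.

(** As [s] is real, the bracket acts separately on the real and imaginary parts of [v], which
    reduces the complex statement to two real ones. *)
Lemma lie_bracket_cplx d (v : 'cV[R]_d -> 'cV[R[i]]_d)
    (s : 'cV[R]_d -> 'cV[R]_d) w :
  lie_bracket v (fun y => cplx (s y)) w =
  cplx (jac s w *m remx (v w) - jac (fun y => remx (v y)) w *m s w) +
  'i%C *: cplx (jac s w *m immx (v w) - jac (fun y => immx (v y)) w *m s w).
Proof.
rewrite /lie_bracket jacc_cplx mul_cplx mul_cplxr Re_jacc Im_jacc.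
by rewrite !cplxB scalerBr opprD addrACA.
Qed.

End complex_matrices.

(** * The closed-loop system on the image of [pi] *)

Theorem theorem1 (R : realType) (n m nu : nat)
  (n_gt0 : (0 < n)%N) (m_gt0 : (0 < m)%N) (nu_gt0 : (0 < nu)%N)
  (f : 'cV[R]_n -> 'cV[R]_n) (g : 'cV[R]_n -> 'M[R]_(n, m))
  (f_C1 : C1 f) (g_C1 : C1 g) (f0 : f 0 = 0)
  (k : 'cV[R]_n -> 'cV[R]_m) (l : 'cV[R]_nu -> 'cV[R]_m)
  (s : 'cV[R]_nu -> 'cV[R]_nu)
  (k_C1 : C1 k) (l_C1 : C1 l) (s_C1 : C1 s)
  (k0 : k 0 = 0) (l0 : l 0 = 0) (s0 : s 0 = 0)
  (* condition 1 *)
  (lambda : 'cV[R]_nu -> R[i]) (v : 'cV[R]_nu -> 'cV[R[i]]_nu)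
  (eig : nonlinear_right_eigenpair [set: 'cV[R]_nu] s lambda v)
  (* condition 2 *)
  (pi : 'cV[R]_nu -> 'cV[R]_n) (pi_C1 : C1 pi)
  (sylvester : forall w, f (pi w) + g (pi w) *m l w = jac pi w *m s w)
  (pi0 : pi 0 = 0) (k_pi : forall w, k (pi w) = l w)
  (* condition 3 *)
  (lambdat : 'cV[R]_n -> R[i]) (vt : 'cV[R]_n -> 'cV[R[i]]_n)
  (lambdat_C0 : continuous (lambdat : 'cV[R]_n -> R[i]^o)) (vt_C1 : C1c vt)
  (lambdat_pi : forall w, lambdat (pi w) = lambda w)
  (vt_pi : forall w, vt (pi w) = cplx (jac pi w) *m v w)
  (vt_neq0 : forall w, vt (pi w) <> 0) :
  nonlinear_right_eigenpair (range pi)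
    (fun x => f x + g x *m k x) lambdat vt.
Proof.
have [_ _ [vr_C1 vi_C1] _ brk] := eig.
have [[vtr_C1 vti_C1] [dvr _] [dvi _]] := And3 vt_C1 vr_C1 vi_C1.
have [[dvtr _] [dvti _] [ds _]] := And3 vtr_C1 vti_C1 s_C1.
have ft_C1 : C1 (fun x => f x + g x *m k x).
  exact: (C1D _ _ f_C1 (C1_mulmx _ _ g_C1 k_C1)).
have [dft _] := ft_C1.
(* The Sylvester equation with [l] replaced by the feedback [k] along [pi] says that [s] and the
   closed-loop field are [pi]-related. *)
have ft_pi w : f (pi w) + g (pi w) *m k (pi w) = jac pi w *m s w.
  by rewrite k_pi sylvester.
split => //; first by rewrite f0 k0 mulmx0 addr0.
  by move=> _ [w _ <-].
(* The right-hand side becomes the pushforward under [jac pi w] of [lambda w *: v w], that is, of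
   the bracket of [v] and [s]; real and imaginary parts are then compared separately. *)
move=> _ [w _ <-]; rewrite lambdat_pi vt_pi scalemxAr -brk// !lie_bracket_cplx.
rewrite mul_cplx Re_cplx Im_cplx; congr (cplx _ + _ *: cplx _).
- apply: (related_bracket pi (fun y => remx (v y)) s) => // x.
  by rewrite vt_pi mul_cplx Re_cplx.
- apply: (related_bracket pi (fun y => immx (v y)) s) => // x.
  by rewrite vt_pi mul_cplx Im_cplx.
Qed.
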